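(* Let $n\ge1$. If $\mathcal{L}\subseteq\mathbb{M}_n$ is a linear subspace consisting of singular matrices, then $\mathcal{L}$ is not transitive.
   Context: $\mathbb{M}_n$ is the space of $n\times n$ complex matrices acting on $\mathbb{C}^n$. A linear subspace $\mathcal{L}\subseteq\mathbb{M}_n$ is transitive if for every nonzero $x\in\mathbb{C}^n$ and every $y\in\mathbb{C}^n$ there is $A\in\mathcal{L}$ with $Ax=y$. *)

(* Defs.v *)
From mathcomp Require Import all_boot all_algebra.
From mathcomp Require Import complex.
From mathcomp Require Import reals.

Set Implicit Arguments.
Unset Strict Implicit.
Unset Printing Implicit Defensive.

Import GRing.Theory.
Local Open Scope ring_scope.
Local Open Scope complex_scope.

(* Matrices act on column vectors on the left; [R : realType] is a model of
   the real numbers, so [R[i]] is the field of complex numbers. *)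
Definition transitive_space (R : realType) (n : nat)
    (L : {vspace 'M[R[i]]_n}) : Prop :=
  forall x : 'cV[R[i]]_n, x != 0 ->
  forall y : 'cV[R[i]]_n, exists2 A : 'M[R[i]]_n, A \in L & A *m x = y.

(* Main.v *)
Require Import Defs.
From mathcomp Require Import all_boot all_algebra.
From mathcomp Require Import complex.
From mathcomp Require Import reals.

(** A transitive space contains matrices of every rank up to [n], hence an
    invertible one.  Suppose [A] in [L] has rank [r < n].  Pick a nonzero [x]
    with [A x = 0] and a vector [y] outside the image of [A]; transitivity gives
    [B] in [L] with [B x = y].  Perturbing a large multiple of [A] by [B] keeps
    the [r] independent directions in which [A] is nonzero, and adds the new
    direction [y], because [(s A + B) x = y] for every [s].  So [s A + B], which
    is still in [L], has rank at least [r + 1] for all but finitely many [s]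
    ([rank_perturbation]).  Iterating from the zero matrix reaches full rank
    ([transitive_rank]), which a space of singular matrices forbids. *)

Local Open Scope ring_scope.
Local Open Scope complex_scope.

Import GRing.Theory.

Lemma row_free_col_mx (F : fieldType) (m n : nat) (C : 'M[F]_(m, n))
    (y : 'rV[F]_n) :
  row_free C -> ~~ (y <= C)%MS -> row_free (col_mx C y).
Proof.
move=> /eqP rC yC; rewrite -row_leq_rank -addsmxE addn1 -{1}rC.
by apply: rank_ltmx; rewrite /ltmx addsmxSl addsmx_sub submx_refl.
Qed.

(** The matrix [s A + B] is caught between two fixed factors.  Write [A = C D]
    with [C] having [r] independent columns, and let [D P = 1], so that
    [A P = C].  Since [A x = 0] and [B x = y],
    [(s A + B) [P, s x] = s [C, y] + [B P, 0]].
    The columns of [[C, y]] are independent, so it has a left inverse [Q], and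
    multiplying by [Q] gives [s + N] with [N] independent of [s]; this is
    invertible of size [r + 1] as soon as [s] is not a root of the
    characteristic polynomial of [- N].  The hypothesis [nonroot] says that the
    field is infinite, in the form in which it is consumed. *)
Lemma rank_perturbation (F : fieldType)
    (nonroot : forall p : {poly F}, p != 0 -> exists s, ~~ root p s)
    (n : nat) (A B : 'M[F]_n) (x : 'cV[F]_n) :
  A *m x = 0 -> ~~ ((B *m x)^T <= A^T)%MS ->
  exists s, (\rank A < \rank (s *: A + B)%R)%N.
Proof.
move=> Ax0 yA; set y := B *m x in yA.
set C := col_base A; set P := pinvmx (row_base A).
have AP : A *m P = C.
  have -> : A *m P = C *m (row_base A *m P) by rewrite mulmxA mulmx_base.
  by rewrite mulmxVp ?row_base_free ?mulmx1.
have CA : (C^T <= A^T)%MS by rewrite -AP trmx_mul submxMl.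
have full : row_full (row_mx C y).
  rewrite /row_full -mxrank_tr tr_row_mx -/(row_free _).
  apply: row_free_col_mx; last by apply: contra yA => /submx_trans; apply.
  by rewrite /row_free mxrank_tr -/(row_full _) col_base_full.
set Q := pinvmx (row_mx C y).
set N := Q *m row_mx (B *m P) (0 : 'cV[F]_n).
have [s sN] := nonroot _ (monic_neq0 (char_poly_monic (- N))).
exists s; set M := s *: A + B.
have QM : Q *m (M *m row_mx P (s *: x)) = s%:M + N.
  have -> : M *m row_mx P (s *: x) = s *: row_mx C y + row_mx (B *m P) 0.
    rewrite mul_mx_row scale_row_mx add_row_mx addr0; congr row_mx.
      by rewrite mulmxDl -scalemxAl AP.
    by rewrite mulmxDl -scalemxAl -!scalemxAr Ax0 !scaler0 add0r.
  by rewrite mulmxDr -scalemxAr mulVpmx // scalemx1.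
have rN : \rank (s%:M + N)%R = (\rank A + 1)%N.
  apply/eqP; move: sN.
  rewrite -eigenvalue_root_char /eigenvalue /eigenspace negbK kermx_eq0.
  by rewrite -opprD /row_free eqmx_opp addrC.
rewrite -addn1 -rN -QM.
exact: leq_trans (mxrankM_maxr _ _) (mxrankM_maxl _ _).
Qed.

Lemma transitive_rank (R : realType) (n : nat) (L : {vspace 'M[R[i]]_n})
    (k : nat) :
  transitive_space L -> (k <= n)%N -> exists2 A, A \in L & (k <= \rank A)%N.
Proof.
move=> trL; elim: k => [|k IHk] lt_kn; first by exists 0; rewrite ?mem0v.
have [A AL] := IHk (ltnW lt_kn).
rewrite leq_eqVlt => /predU1P[kA | ]; last by exists A.
have singA : ~~ row_free A^T by rewrite /row_free mxrank_tr -kA ltn_eqF.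
have /rowV0Pn[u /sub_kermxP uA u0] : kermx A^T != 0 by rewrite kermx_eq0.
have /row_subPn[j yA] : ~~ ((1%:M : 'M[R[i]]_n) <= A^T)%MS.
  by rewrite sub1mx /row_full -/(row_free A^T).
have x0 : u^T != 0 by rewrite -trmx0 (inj_eq trmx_inj).
have [B BL Bx] := trL _ x0 (row j 1%:M)^T.
have [|||s rs] := @rank_perturbation _ _ n A B u^T.
- by move=> p /closed_nonrootP.
- by rewrite -[A]trmxK -trmx_mul uA trmx0.
- by rewrite Bx trmxK.
by exists (s *: A + B); rewrite ?memvD ?memvZ // kA.
Qed.

Theorem proposition5p1 (R : realType) (n : nat) (hn : (1 <= n)%N)
    (L : {vspace 'M[R[i]]_n})
    (hL : forall A : 'M[R[i]]_n, A \in L -> A \notin unitmx) :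
  ~ transitive_space L.
Proof.
move=> trL; have [A AL rA] := @transitive_rank R n L n trL (leqnn n).
by have := hL A AL; rewrite -row_free_unit -row_leq_rank rA.
Qed.
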